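(* Let $\mathcal{C}_e=\{C_4,C_6,C_8,\dots\}$ be the family of all even cycles. For every integer $k\geq 4$, $\mathcal{E}_{\mathcal{C}_e}(k)=\lfloor k^2/4\rfloor$. Moreover, for $k\geq 6$ the unique simple graph $G$ (without isolated vertices) with $\operatorname{ex}(G,\mathcal{C}_e)<k$ and $e(G)=\lfloor k^2/4\rfloor$ is the complete bipartite graph $K_{\lfloor k/2\rfloor,\lceil k/2\rceil}$.
   Context: Graphs are finite, simple, 2-uniform, without isolated vertices. For a graph $G$ and a family of graphs $\mathcal{H}$, $\operatorname{ex}(G,\mathcal{H})$ is the maximum number of edges of a subgraph $F\subseteq G$ containing no member of $\mathcal{H}$ as a subgraph. $\mathcal{E}_\mathcal{H}(k):=\sup\{e(G): G \text{ simple graph with } \operatorname{ex}(G,\mathcal{H})<k\}$. *)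

(* Defs.v *)
From mathcomp Require Import all_boot.
Set Implicit Arguments. Unset Strict Implicit. Unset Printing Implicit Defensive.

Definition simple_graph (T : finType) (E : {set {set T}}) : bool :=
  [forall e in E, #|e| == 2].

Definition no_isolated (T : finType) (E : {set {set T}}) : bool :=
  [forall v : T, [exists e in E, v \in e]].

Definition has_cycle (T : finType) (F : {set {set T}}) (n : nat) : bool :=
  (3 <= n) && [exists f : {ffun 'I_n -> T},
     injectiveb f && [forall i : 'I_n, [set f i; f (ordS i)] \in F]].

(* F contains no even cycle C_4, C_6, C_8, ... as a subgraph.
   (A cycle in F has at most #|T| vertices, so n ranges over n <= #|T|.) *)
Definition even_cycle_free (T : finType) (F : {set {set T}}) : bool :=
  [forall n : 'I_#|T|.+1, ((4 <= n) && ~~ odd n) ==> ~~ has_cycle F n].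

Definition ex_even_cycles (T : finType) (E : {set {set T}}) : nat :=
  \max_(F in powerset E | even_cycle_free F) #|F|.

Definition K_bip (a b : nat) : {set {set ('I_a + 'I_b)%type}} :=
  [set [set inl i; inr j] | i : 'I_a, j : 'I_b].

Definition graph_iso (T1 T2 : finType) (E1 : {set {set T1}}) (E2 : {set {set T2}}) : Prop :=
  exists f : T1 -> T2, bijective f /\ forall e : {set T1}, (e \in E1) = (f @: e \in E2).

(* Main.v *)
Require Import Defs.
From mathcomp Require Import all_boot.
From mathcomp Require Import zify.

(* Write ex for ex(G, C_e) and n for the number of vertices. Attaching a pendant
   edge, or a triangle at a vertex, to a subgraph without even cycles creates no
   even cycle. Hence deleting a non-isolated vertex lowers ex by at least 1, and
   a vertex of degree at most k/2 can be deleted by induction. If all degrees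
   exceed k/2, every two vertices are equal, adjacent or have a common neighbour;
   a star at v spanning its neighbourhood, completed by a matching of size m in
   that neighbourhood and by pendant edges, has n - 1 + m edges. Every vertex of
   N(v) has more than k - n neighbours in N(v), which yields m = k - n + 1 unless
   deg v <= 2(k - n) + 1. The latter for all v gives e <= (k+1)(2k-1)/9.
   In an extremal graph with k >= 6 all degrees are at least floor(k/2), and the
   same argument, applied at a vertex of maximal degree, forces n = k; then the
   graph is triangle-free and some edge uv has deg u + deg v = k, so N(u) and
   N(v) are the sides of a complete bipartite graph. *)

Set Implicit Arguments.
Unset Strict Implicit.
Unset Printing Implicit Defensive.

(** * Cyclic successors of ordinals, and unordered pairs *)

Lemma val_iter_ordS n (i : 'I_n) k : val (iter k (@ordS n) i) = (i + k) %% n.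
Proof.
elim: k => [|k IHk] /=; first by rewrite addn0 modn_small.
by rewrite IHk -addn1 modnDml -addnA addn1.
Qed.

Lemma iter_ordS_neq n (i : 'I_n) k : 0 < k < n -> iter k (@ordS n) i != i.
Proof.
case/andP=> k_gt0 k_lt_n; apply/eqP => /(congr1 val); rewrite val_iter_ordS => ik.
have /eqP : i + k = i + 0 %[mod n] by rewrite addn0 ik modn_small.
by rewrite eqn_modDl mod0n modn_small // -leqn0 leqNgt k_gt0.
Qed.

Lemma set2C (T : finType) (x y : T) : [set x; y] = [set y; x].
Proof. by rewrite setUC. Qed.

Lemma set2_injr (T : finType) (x y z : T) : [set x; y] = [set x; z] -> y = z.
Proof.
move=> eq_xyz; have: y \in [set x; z] by rewrite -eq_xyz set22.
have: z \in [set x; y] by rewrite eq_xyz set22.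
by rewrite !inE => /orP[/eqP->|/eqP->//] /orP[/eqP->|/eqP->].
Qed.

(** * Attaching pendant edges and triangles without creating even cycles *)

Section EvenCycleFree.
Variable T : finType.
Implicit Types (E F : {set {set T}}) (x y z : T).

Definition even_cycle F n (f : 'I_n -> T) :=
  [/\ 4 <= n, ~~ odd n, injective f & forall i, [set f i; f (ordS i)] \in F].

(** An injective [f] forces [n <= #|T|], so the bound on the length in [even_cycle_free] loses no
    cycle. *)
Lemma even_cycle_freeP F :
  reflect (forall n (f : 'I_n -> T), ~ even_cycle F f) (even_cycle_free F).
Proof.
apply: (iffP forallP) => [F_free n f [n4 n_even inj_f fF]|F_free n].
  have n_le : n < #|T|.+1 by rewrite ltnS -[n]card_ord (leq_card f).
  have /implyP/(_ _)/negP[] := F_free (Ordinal n_le); rewrite /= ?n4 //.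
  rewrite /has_cycle (ltnW n4); apply/existsP; exists (finfun f).
  apply/andP; split; first by apply/injectiveP => i j; rewrite !ffunE; apply: inj_f.
  by apply/forallP => i; rewrite !ffunE.
apply/implyP => /andP[n4 n_even]; apply/negP => /andP[_ /existsP[f]].
case/andP => /injectiveP inj_f /forallP fF.
by apply: (F_free n f); split.
Qed.

Lemma even_cycle_ordS F n (f : 'I_n -> T) k i :
  even_cycle F f -> 0 < k < 4 -> f (iter k (@ordS n) i) != f i.
Proof.
case=> n4 _ inj_f _ /andP[k0 k4]; apply/eqP => /inj_f; apply/eqP.
by apply: iter_ordS_neq; rewrite k0 (leq_trans k4).
Qed.

(** A vertex of a cycle has two distinct neighbours on it, whereas [x] has only [y]. *)
Lemma even_cycle_free_pendant F x y :
    (forall e, e \in F -> x \notin e) -> x != y ->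
  even_cycle_free F -> even_cycle_free ([set x; y] |: F).
Proof.
move=> xF neq_xy /even_cycle_freeP F_free; apply/even_cycle_freeP => n f cf.
have [n4 n_even inj_f fF'] := cf.
have nbr z : [set x; z] \in [set x; y] |: F -> z = y.
  by case/setU1P=> [/set2_injr // | /xF]; rewrite set21.
have f_x i : f i != x.
  apply/eqP => fi.
  have fi1 : f (ordS i) = y by apply: nbr; have := fF' i; rewrite fi.
  have fi_1 : f (ord_pred i) = y.
    by apply: nbr; have := fF' (ord_pred i); rewrite ord_predK fi set2C.
  have := @even_cycle_ordS _ _ _ 2 (ord_pred i) cf isT.
  by rewrite /= ord_predK fi1 fi_1 eqxx.
apply: (F_free n f); split => // i; have /setU1P[eq_xy|//] := fF' i.
have: x \in [set f i; f (ordS i)] by rewrite eq_xy set21.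
by rewrite !inE ![x == _]eq_sym !(negPf (f_x _)).
Qed.

(* A cycle through x or y runs through x, y, z consecutively, so the third step
   after one of them closes it up: its length is 3. *)
Lemma even_cycle_free_triangle F x y z :
    (forall e, e \in F -> x \notin e) -> (forall e, e \in F -> y \notin e) ->
    x != y -> x != z -> y != z -> even_cycle_free F ->
  even_cycle_free ([set x; y] |: ([set x; z] |: ([set y; z] |: F))).
Proof.
set F' := _ |: _ => xF yF neq_xy neq_xz neq_yz /even_cycle_freeP F_free.
apply/even_cycle_freeP => n f cf; have [n4 n_even inj_f fF'] := cf.
have nbrx u : [set x; u] \in F' -> u = y \/ u = z.
  case/setU1P=> [/set2_injr|]; first by left.
  case/setU1P=> [/set2_injr|]; first by right.
  case/setU1P=> [e|/xF]; last by rewrite set21.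
  by have := set21 x u; rewrite e !inE (negPf neq_xy) (negPf neq_xz).
have nbry u : [set y; u] \in F' -> u = x \/ u = z.
  case/setU1P=> [|]; first by rewrite [RHS]set2C => /set2_injr; left.
  case/setU1P=> [e|].
    by have := set21 y u; rewrite e !inE eq_sym (negPf neq_xy) (negPf neq_yz).
  case/setU1P=> [/set2_injr|/yF]; first by right.
  by rewrite set21.
have F'p i : [set f i; f (ord_pred i)] \in F'.
  by have := fF' (ord_pred i); rewrite ord_predK set2C.
(* Stated for [a] and [b] so as to serve both [x] and [y]. The cycle passes from [a] to [b] and [z]
   in one of two directions. *)
have f_xy a b i : (forall u, [set a; u] \in F' -> u = b \/ u = z) ->
                  (forall u, [set b; u] \in F' -> u = a \/ u = z) -> f i <> a.
  move=> nbra nbrb fi.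
  have := fF' i; have := F'p i; rewrite fi => /nbra p /nbra s.
  have /eqP neq_sp := @even_cycle_ordS _ _ _ 2 (ord_pred i) cf isT.
  rewrite /= ord_predK in neq_sp.
  have {s p} [[s p]|[s p]] : (f (ordS i) = b /\ f (ord_pred i) = z)
                    \/ (f (ordS i) = z /\ f (ord_pred i) = b).
    case: s p => [s|s] [p|p]; rewrite s p in neq_sp => //; by [left | right].
  - have := fF' (ordS i); rewrite s => /nbrb[ss|ss].
      by have /eqP[] := @even_cycle_ordS _ _ _ 2 i cf isT; rewrite /= ss fi.
    have /eqP[] := @even_cycle_ordS _ _ _ 3 (ord_pred i) cf isT.
    by rewrite /= ord_predK ss p.
  have := F'p (ord_pred i); rewrite p => /nbrb[pp|pp].
    have /eqP[] := @even_cycle_ordS _ _ _ 2 (ord_pred (ord_pred i)) cf isT.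
    by rewrite /= !ord_predK pp fi.
  have /eqP[] := @even_cycle_ordS _ _ _ 3 (ord_pred (ord_pred i)) cf isT.
  by rewrite /= !ord_predK pp s.
have f_x i : f i <> x by apply: (f_xy x y).
have f_y i : f i <> y by apply: (f_xy y x).
apply: (F_free n f); split => // i; have := fF' i.
case/setU1P=> [e|].
  by have := set21 x y; rewrite -e => /set2P[] /esym /f_x.
case/setU1P=> [e|].
  by have := set21 x z; rewrite -e => /set2P[] /esym /f_x.
case/setU1P=> [e|//].
by have := set21 y z; rewrite -e => /set2P[] /esym /f_y.
Qed.

End EvenCycleFree.

(** * Induced subgraphs, their extremal numbers, and matchings *)

Section InducedSubgraphs.
Variables (T : finType) (E : {set {set T}}).
Hypothesis simpleE : simple_graph E.
Implicit Types (C D N S : {set T}) (x y z u v : T).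

Definition adj x y := [set x; y] \in E.
Definition nbhd C x := [set y in C | adj x y].
(** Subgraphs are given by vertex sets in one fixed type, so that deleting a vertex changes [C] but
    not the type. *)
Definition induced C := [set e in E | e \subset C].
Definition ex_on C := ex_even_cycles (induced C).

Lemma adjC x y : adj x y = adj y x.
Proof. by rewrite /adj set2C. Qed.

Lemma adj_neq x y : adj x y -> x != y.
Proof.
move=> xyE; have := forallP simpleE [set x; y]; rewrite -/(adj x y) xyE cards2.
by case: (x != y).
Qed.

Lemma in_nbhd C x y : (y \in nbhd C x) = (y \in C) && adj x y.
Proof. by rewrite inE. Qed.

Lemma nbhd_notin C x : x \notin nbhd C x.
Proof. by rewrite in_nbhd negb_and; apply/orP; right; apply/negP => /adj_neq/eqP. Qed.

Lemma nbhd_sub C x : nbhd C x \subset C.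
Proof. by apply/subsetP => y; rewrite in_nbhd => /andP[]. Qed.

Lemma card_nbhd_ltn C x : x \in C -> #|nbhd C x| < #|C|.
Proof.
move=> xC; apply: proper_card; rewrite properE nbhd_sub /=.
by apply: contra (nbhd_notin C x) => /subsetP; apply.
Qed.

Lemma edge_nbhd C v e : e \in induced C -> v \in e ->
  exists2 y, y \in nbhd C v & e = [set v; y].
Proof.
rewrite inE => /andP[eE /subsetP eC] ve.
have /cards2P[x [y [_ def_e]]] : #|e| == 2.
  by have := forallP simpleE e; rewrite eE.
have [a def_ea] : exists a, e = [set v; a].
  move: ve; rewrite def_e => /set2P[->|->]; first by exists y.
  by exists x; rewrite set2C.
exists a => //; rewrite in_nbhd /adj -def_ea eE andbT.
by apply: eC; rewrite def_ea set22.
Qed.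

Lemma edgeP C e : e \in induced C ->
  exists x y, [/\ x \in C, y \in nbhd C x & e = [set x; y]].
Proof.
move=> eC; have := eC; rewrite inE => /andP[eE /subsetP sC].
have /cards2P[x [y [_ def_e]]] : #|e| == 2.
  by have := forallP simpleE e; rewrite eE.
have xe : x \in e by rewrite def_e set21.
by have [z zN ->] := edge_nbhd eC xe; exists x, z; split => //; apply: sC.
Qed.

Lemma card_star C v : v \in C ->
  #|[set e in induced C | v \in e]| = #|nbhd C v|.
Proof.
move=> vC; rewrite -(card_imset (f := fun y => [set v; y]) (mem (nbhd C v))); last first.
  by move=> x y; apply: set2_injr.
congr #|pred_of_set _|; apply/setP => e; rewrite inE.
apply/andP/imsetP => [[eC ve]|[y yN ->]].
  by have [y] := edge_nbhd eC ve; exists y.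
have := yN; rewrite in_nbhd => /andP[yC yE]; rewrite set21 inE [_ \in E]yE.
by split=> //; apply/subsetP => z /set2P[] ->.
Qed.

Lemma card_induced_rem C v : v \in C ->
  #|induced C| = #|induced (C :\ v)| + #|nbhd C v|.
Proof.
move=> vC; rewrite -card_star // -(cardsID [set e : {set T} | v \in e] (induced C)) addnC.
congr (_ + _); congr #|pred_of_set _|; apply/setP => e; rewrite !inE //.
by rewrite subsetD1 andbC -andbA; congr (_ && _); rewrite andbC.
Qed.

Lemma handshake C : \sum_(x in C) #|nbhd C x| = 2 * #|induced C|.
Proof.
under eq_bigr => x xC do rewrite -(card_star xC) -sum1_card.
under eq_bigr => x xC do under eq_bigl => e do rewrite inE.
rewrite (exchange_big_dep (mem (induced C))) /=; last by move=> x e _ /andP[].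
rewrite mulnC -sum_nat_const; apply: eq_bigr => e eC; rewrite sum1_card.
have -> : 2 = #|e|.
  by have := forallP simpleE e; have := eC; rewrite inE => /andP[-> _] /eqP.
have := eC; rewrite inE => /andP[eE sC].
apply: eq_card => x; rewrite [x \in _]unfold_in /= eE sC /=.
by have [/(subsetP sC) -> | _] := boolP (x \in e); rewrite ?andbF.
Qed.

Lemma card_induced_le C : 2 * #|induced C| <= #|C| * #|C|.-1.
Proof.
rewrite -handshake -sum_nat_const; apply: leq_sum => x xC.
by rewrite -ltnS prednK ?card_nbhd_ltn //; apply/card_gt0P; exists x.
Qed.

Lemma ex_on_sup C (F : {set {set T}}) :
  F \subset induced C -> even_cycle_free F -> #|F| <= ex_on C.
Proof.
move=> sF Ffree; rewrite /ex_on /ex_even_cycles.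
rewrite (bigD1 F) ?leq_maxl //=; last by rewrite powersetE sF.
Qed.

Lemma ex_on_witness C :
  exists F : {set {set T}}, [/\ F \subset induced C, even_cycle_free F & #|F| = ex_on C].
Proof.
pose P (F : {set {set T}}) := (F \in powerset (induced C)) && even_cycle_free F.
have [|F] := @eq_bigmax_cond _ P (fun F : {set {set T}} => #|F|).
  (* The maximum is attained because its index family contains [set0]. *)
  apply/card_gt0P; exists set0; rewrite unfold_in /P powersetE sub0set /=.
  apply/even_cycle_freeP => n f [n4 _ _ /(_ (Ordinal (ltnW (ltnW (ltnW n4)))))].
  by rewrite inE.
by rewrite unfold_in /P powersetE => /andP[sF Ff] eF; exists F; rewrite -eF.
Qed.

Lemma induced_sub C D : C \subset D -> induced C \subset induced D.
Proof.
move=> sCD; apply/subsetP => e; rewrite !inE => /andP[-> eC] /=.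
exact: subset_trans sCD.
Qed.

Lemma induced_edge C x y : x \in C -> y \in C -> adj x y -> [set x; y] \in induced C.
Proof. by move=> xC yC xy; rewrite inE [_ \in E]xy; apply/subsetP => z /set2P[] ->. Qed.

Lemma ex_onS C D : C \subset D -> ex_on C <= ex_on D.
Proof.
move=> sCD; have [F [sF Ff <-]] := ex_on_witness C.
by apply: ex_on_sup => //; apply: subset_trans (induced_sub sCD).
Qed.

Lemma notin_sub_induced C x (F : {set {set T}}) :
  x \notin C -> F \subset induced C -> forall e, e \in F -> x \notin e.
Proof.
move=> xC /subsetP sF e /sF; rewrite inE => /andP[_ /subsetP eC].
by apply: contra xC => /eC.
Qed.

(** As [x] lies outside [C], the new edge is pendant on an optimal edge set inside [C]. *)
Lemma ex_on_pendant C D x y :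
  C \subset D -> x \in D -> x \notin C -> y \in D -> adj x y -> ex_on C < ex_on D.
Proof.
move=> sCD xD xC yD xy; have [F [sF Ff <-]] := ex_on_witness C.
have xF := notin_sub_induced xC sF.
have eF : [set x; y] \notin F by apply/negP => /xF; rewrite set21.
have -> : #|F|.+1 = #|[set x; y] |: F| by rewrite cardsU1 eF.
apply: ex_on_sup; last exact: even_cycle_free_pendant xF (adj_neq xy) Ff.
by rewrite subUset sub1set induced_edge // (subset_trans sF) // induced_sub.
Qed.

(** Two new vertices bring three edges, one more than two pendant edges would; each pair of a
    matching will yield this surplus. *)
Lemma ex_on_triangle C D x y z :
    C \subset D -> x \in D -> x \notin C -> y \in D -> y \notin C -> z \in C ->
    adj x y -> adj x z -> adj y z ->
  ex_on C + 3 <= ex_on D.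
Proof.
move=> sCD xD xC yD yC zC xy xz yz; have [F [sF Ff <-]] := ex_on_witness C.
have xF := notin_sub_induced xC sF; have yF := notin_sub_induced yC sF.
have zD := subsetP sCD z zC.
have [[nxy nxz] nyz] := (adj_neq xy, adj_neq xz, adj_neq yz).
pose F' := [set x; y] |: ([set x; z] |: ([set y; z] |: F)).
have -> : #|F| + 3 = #|F'|.
  have e3 : [set y; z] \notin F by apply/negP => /yF; rewrite set21.
  have e2 : [set x; z] \notin [set y; z] |: F.
    apply/negP => /setU1P[e|/xF]; last by rewrite set21.
    by have := set21 x z; rewrite e !inE (negPf nxy) (negPf nxz).
  have e1 : [set x; y] \notin [set x; z] |: ([set y; z] |: F).
    apply/negP => /setU1P[/set2_injr/eqP|]; first by rewrite (negPf nyz).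
    move=> /setU1P[e|/xF]; last by rewrite set21.
    by have := set21 x y; rewrite e !inE (negPf nxy) (negPf nxz).
  by rewrite /F' cardsU1 e1 cardsU1 e2 cardsU1 e3 addnC.
apply: ex_on_sup; last exact: (even_cycle_free_triangle xF yF).
by rewrite !subUset !sub1set !induced_edge // (subset_trans sF) // induced_sub.
Qed.

(** Each vertex of [D :\: C] is hung on [C] by one pendant edge. *)
Lemma ex_on_grow C D : C \subset D ->
    (forall x, x \in D :\: C -> exists2 y, y \in C & adj x y) ->
  ex_on C + #|D :\: C| <= ex_on D.
Proof.
elim: {D}#|D :\: C| {-2}D (erefl #|D :\: C|) => [|n IHn] D card_D sCD nbrD.
  by rewrite card_D addn0 ex_onS.
have /card_gt0P[x] : 0 < #|D :\: C| by rewrite card_D.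
move=> xDC; have := xDC; rewrite inE => /andP[xC xD].
have [y yC xy] := nbrD x xDC.
have e : (D :\ x) :\: C = (D :\: C) :\ x by rewrite !setDDl setUC.
have card_Dx : #|(D :\ x) :\: C| = n.
  by have := cardsD1 x (D :\: C); rewrite xDC card_D e; lia.
have sC : C \subset D :\ x by rewrite subsetD1 sCD.
have := IHn (D :\ x) card_Dx sC.
have : ex_on (D :\ x) < ex_on D.
  apply: (@ex_on_pendant _ _ x y) => //; [exact: subD1set | by rewrite !inE eqxx |].
  exact: (subsetP sCD).
rewrite card_D card_Dx => lt le.
have {}le : ex_on C + n <= ex_on (D :\ x).
  by apply: le => w; rewrite e inE => /andP[_]; apply: nbrD.
lia.
Qed.

(** A derivation lists the [m] pairs of a matching covering [S]; induction on it handles one pair at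
    a time. *)
Inductive perfect_matching : nat -> {set T} -> Prop :=
| PerfectMatching0 : perfect_matching 0 set0
| PerfectMatchingS m S a b :
    adj a b -> a \notin S -> b \notin S -> perfect_matching m S ->
    perfect_matching m.+1 (a |: (b |: S)).

Lemma card_perfect_matching m S : perfect_matching m S -> #|S| = 2 * m.
Proof.
elim=> [|{}m {}S a b /adj_neq ab aS bS _ IH]; first by rewrite cards0.
by rewrite !cardsU1 !inE negb_or ab aS bS IH; lia.
Qed.

(** By pigeonhole some pair [a], [b] receives at least three of the four possible edges from [x] and
    [y]. It is then exchanged for the pairs [x a], [y b] or [x b], [y a]. *)
Lemma perfect_matching_augment m S x y :
    perfect_matching m S -> x != y -> x \notin S -> y \notin S ->
    2 * m < #|nbhd S x| + #|nbhd S y| ->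
  perfect_matching m.+1 (x |: (y |: S)).
Proof.
move=> pmS neq_xy; elim: pmS => [|{}m {}S a b ab aS bS pmS IH].
  by rewrite /nbhd; do 2!rewrite (_ : [set _ in set0 | _] = set0) ?cards0 //;
    apply/setP => z; rewrite !inE.
rewrite !inE !negb_or => /and3P[xa xb xS] /and3P[ya yb yS].
have nab := adj_neq ab.
have card_nbhdU z : #|nbhd (a |: (b |: S)) z| = adj z a + (adj z b + #|nbhd S z|).
  rewrite [LHS](cardsD1 a) in_nbhd setU11 /=; congr (_ + _).
  rewrite (cardsD1 b) !inE eq_sym nab eqxx orbT /=; congr (_ + _).
  apply: eq_card => w; rewrite !inE.
  case: (eqVneq w b) => [->|_] /=; first by rewrite (negPf bS).
  by case: (eqVneq w a) => [->|_] /=; first by rewrite (negPf aS).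
rewrite !card_nbhdU => deg.
(* If the remaining pairs still carry a surplus, the exchange happens among them; otherwise it
   happens at [a], [b]. *)
have [IHdeg|le_deg] := ltnP (2 * m) (#|nbhd S x| + #|nbhd S y|).
  have -> : x |: (y |: (a |: (b |: S))) = a |: (b |: (x |: (y |: S))).
    by apply/setP => w; rewrite !inE; case: (w == x); case: (w == y); case: (w == a); case: (w == b).
  apply: PerfectMatchingS (IH xS yS IHdeg) => //; rewrite !inE !negb_or.
    by rewrite ![a == _]eq_sym xa ya.
  by rewrite ![b == _]eq_sym xb yb.
have [[xa_adj yb_adj]|[xb_adj ya_adj]] :
    (adj x a /\ adj y b) \/ (adj x b /\ adj y a).
  move: deg le_deg; case: (adj x a); case: (adj x b); case: (adj y a);
    case: (adj y b); try (by left); try (by right); clear; lia.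
- have -> : x |: (y |: (a |: (b |: S))) = x |: (a |: (y |: (b |: S))).
    by apply/setP => w; rewrite !inE; case: (w == x); case: (w == y); case: (w == a); case: (w == b).
  apply: PerfectMatchingS; rewrite ?inE ?negb_or ?xa ?neq_xy ?xb ?xS //.
    by rewrite eq_sym ya nab aS.
  by apply: PerfectMatchingS.
have -> : x |: (y |: (a |: (b |: S))) = x |: (b |: (y |: (a |: S))).
  by apply/setP => w; rewrite !inE; case: (w == x); case: (w == y); case: (w == a); case: (w == b).
apply: PerfectMatchingS; rewrite ?inE ?negb_or ?xa ?neq_xy ?xb ?xS //.
  by rewrite eq_sym yb eq_sym nab bS.
by apply: PerfectMatchingS.
Qed.

(** While [m < r], two vertices of [N] are uncovered. Either they augment the matching, or one of
    them has at most [m] neighbours in [S], hence a partner in [N] outside [S]. *)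
Lemma perfect_matching_exists N r :
    2 * r <= #|N| -> (forall x, x \in N -> r <= #|nbhd N x|) ->
  exists2 S : {set T}, S \subset N & perfect_matching r S.
Proof.
move=> rN degN.
have: forall m, m <= r -> exists2 S : {set T}, S \subset N & perfect_matching m S; last exact.
elim=> [|m IHm] lt_mr.
  by exists set0; [exact: sub0set | exact: PerfectMatching0].
have [S sSN pmS] := IHm (ltnW lt_mr); have cardS := card_perfect_matching pmS.
have cardD : 1 < #|N :\: S| by have := cardsD N S; rewrite (setIidPr sSN); lia.
have /card_gt1P[x [y [xD yD neq_xy]]] := cardD.
move: xD yD; rewrite !inE => /andP[xS xN] /andP[yS yN].
have [aug|le_deg] := ltnP (2 * m) (#|nbhd S x| + #|nbhd S y|).
  exists (x |: (y |: S)); last exact: perfect_matching_augment.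
  by rewrite !subUset !sub1set xN yN.
have ext w : w \in N -> w \notin S -> #|nbhd S w| <= m ->
    exists2 S : {set T}, S \subset N & perfect_matching m.+1 S.
  move=> wN wS le_m.
  have /subsetPn[z] : ~~ (nbhd N w \subset nbhd S w).
    by apply/negP => /subset_leq_card; have := degN w wN; lia.
  rewrite !in_nbhd => /andP[zN wz]; rewrite wz andbT => zS.
  exists (w |: (z |: S)); first by rewrite !subUset !sub1set wN zN.
  exact: PerfectMatchingS.
have [le_x|lt_x] := leqP #|nbhd S x| m; first exact: (ext x).
by apply: (ext y) => //; lia.
Qed.

(* The triangles on v and the pairs of the matching form a cactus. *)
Lemma ex_on_friendship C v m S :
    v \in C -> S \subset nbhd C v -> perfect_matching m S ->
    (forall u, u \in C -> u != v -> ~~ adj u v ->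
       exists2 w, w \in nbhd C v & adj u w) ->
  #|C|.-1 + m <= ex_on C.
Proof.
move=> vC sSN pmS dist2.
have vN := nbhd_notin C v.
have vS : v \notin S by apply: contra vN => /(subsetP sSN).
have sNC : v |: nbhd C v \subset C by rewrite subUset sub1set vC nbhd_sub.
(* One triangle through [v] for each pair of the matching. *)
have step1 : 3 * m <= ex_on (v |: S).
  elim: pmS sSN {vS} => [|{}m {}S a b ab aS bS _ IH]; first by [].
  rewrite !subUset !sub1set !in_nbhd => /and3P[/andP[aC va] /andP[bC vb] sSN].
  have := IH sSN.
  have := @ex_on_triangle (v |: S) (v |: (a |: (b |: S))) a b v.
  have := adj_neq va; have := adj_neq vb; rewrite ![v == _]eq_sym => bv av.
  rewrite adjC in va; rewrite adjC in vb.
  rewrite !inE !eqxx !orbT !negb_or av aS bv bS ab va vb.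
  have -> : v |: S \subset v |: (a |: (b |: S)) by rewrite setUS // setUA subsetUr.
  move=> /(_ isT isT isT isT isT isT isT isT isT) le3 IHm.
  by rewrite mulnS addnC (leq_trans _ le3) ?leq_add2r.
(* The other neighbours of [v] are hung on [v]. *)
have step2 : ex_on (v |: S) + #|(v |: nbhd C v) :\: (v |: S)| <= ex_on (v |: nbhd C v).
  apply: ex_on_grow; first exact: setUS.
  move=> x; rewrite !inE negb_or => /andP[/andP[/negPf-> _]] /= /andP[_ vx].
  by exists v; [exact: setU11 | rewrite adjC].
(* All remaining vertices are hung on neighbours of [v]. *)
have step3 : ex_on (v |: nbhd C v) + #|C :\: (v |: nbhd C v)| <= ex_on C.
  apply: ex_on_grow => // x; rewrite !inE negb_or => /andP[/andP[xv]].
  move=> xN xC; rewrite xC /= adjC in xN; have [w wN xw] := dist2 x xC xv xN.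
  by exists w => //; rewrite inE wN orbT.
(* With [d] the degree of [v] and [n] the order of [C], the stages add up to
   [3 m + (d - 2 m) + (n - 1 - d)] edges. *)
have := cardsD (v |: nbhd C v) (v |: S); rewrite (setIidPr (setUS _ sSN)).
have := cardsD C (v |: nbhd C v); rewrite (setIidPr sNC).
have := subset_leq_card sNC; have := subset_leq_card sSN.
rewrite !cardsU1 vN vS (card_perfect_matching pmS); lia.
Qed.

End InducedSubgraphs.

(** * Arithmetic of floor(k^2/4) *)

Section Arithmetic.
Implicit Types (k n d e : nat).

Lemma quarter_sqrE k : k ^ 2 %/ 4 = k./2 * uphalf k.
Proof.
rewrite uphalf_half -{1}[k]odd_double_half; case: (odd k); move: k./2 => a.
  have -> : (true + a.*2) ^ 2 = a * (true + a) * 4 + 1 by rewrite -mulnn; lia.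
  by rewrite divnMDl // divn_small ?addn0.
have -> : (false + a.*2) ^ 2 = a * (false + a) * 4 by rewrite -mulnn; lia.
by rewrite mulnK.
Qed.

(** The increment is the largest degree whose loss is paid for by lowering [k.+1] to [k]. *)
Lemma quarter_sqr_step k : k.+1 ^ 2 %/ 4 = k ^ 2 %/ 4 + k.+1./2.
Proof. by rewrite !quarter_sqrE /= mulnS addnC mulnC. Qed.

(* The two bounds cross at n = (2k+2)/3. *)
Lemma dense_edge_bound n k e :
    n <= k -> 2 * e <= n * n.-1 -> 2 * e <= n * (2 * (k - n) + 1) ->
  9 * e <= (k + 1) * (2 * k).-1.
Proof.
move=> nk; case: n nk => [|n] nk; first by lia.
case: k nk => // k nk; rewrite succnK => e1 e2.
have [le|lt] := leqP (3 * n) (2 * k + 1).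
  have : 3 * n.+1 * (3 * n) <= (2 * k + 4) * (2 * k + 1) by apply: leq_mul; lia.
  nia.
(* Here [n] and [k] stand for the predecessors of the original values. [t] is the excess over the
   crossing point, and the product of the two factors is largest at [t = 0]. *)
have [t def_n] : exists t, 3 * n = 2 * k + 1 + t by exists (3 * n - (2 * k + 1)); lia.
have := leq_mul (leqnn 9) e2.
have -> : 9 * (n.+1 * (2 * (k.+1 - n.+1) + 1)) =
   (3 * n.+1) * (3 * (2 * (k - n) + 1)) by rewrite subSS; lia.
have -> : 3 * n.+1 = 2 * k + 4 + t by lia.
have -> : 3 * (2 * (k - n) + 1) = 2 * k + 1 - 2 * t by lia.
have : (2 * k + 4 + t) * (2 * k + 1 - 2 * t) <= (2 * k + 4) * (2 * k + 1) by nia.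
nia.
Qed.

(** As 2/9 < 1/4, the bound (k+1)(2k-1)/9 lies below floor(k^2/4) from [k = 6] on. At [k = 5] it
    gives 6, which is floor(25/4); for smaller [k] the values of [n] are enumerated. *)
Lemma dense_quarter n k e :
    n <= k -> 2 * e <= n * n.-1 -> 2 * e <= n * (2 * (k - n) + 1) ->
  e <= k ^ 2 %/ 4 /\ (5 < k -> e < k ^ 2 %/ 4).
Proof.
move=> nk e1 e2; have e9 := dense_edge_bound nk e1 e2.
have qk : k ^ 2 <= 4 * (k ^ 2 %/ 4) + 1.
  rewrite quarter_sqrE uphalf_half -{1}[k]odd_double_half -mulnn.
  by case: (odd k); lia.
have lt_e : 5 < k -> e < k ^ 2 %/ 4.
  by move=> k5; move: qk e9; rewrite -mulnn; move: (_ %/ 4) => q; nia.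
split=> //; have [/lt_e/ltnW //|k5] := ltnP 5 k.
have [k4|k5'] := ltnP k 5; last first.
  have k5e : k = 5 by apply/eqP; rewrite eqn_leq k5.
  rewrite k5e in e9 *; rewrite (_ : 5 ^ 2 %/ 4 = 6) //; move: e9; clear; lia.
case: k k4 nk e1 e2 {e9 qk lt_e k5} => [|[|[|[|[|//]]]]] _.
- by case: n => //=; lia.
- by case: n => [|[|//]] /=; lia.
- by case: n => [|[|[|//]]] /= _; rewrite (_ : 2 ^ 2 %/ 4 = 1) //; lia.
- by case: n => [|[|[|[|//]]]] /= _; rewrite (_ : 3 ^ 2 %/ 4 = 2) //; lia.
- by case: n => [|[|[|[|[|//]]]]] /= _; rewrite (_ : 4 ^ 2 %/ 4 = 4) //; lia.
Qed.

End Arithmetic.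

(** * The upper bound and the structure of extremal graphs *)

Section Extremal.
Variables (T : finType) (E : {set {set T}}).
Hypothesis simpleE : simple_graph E.
Implicit Types (C D N S : {set T}) (x y z u v : T).

Local Notation adj := (adj E).
Local Notation nbhd := (nbhd E).
Local Notation induced := (induced E).
Local Notation ex_on := (ex_on E).

(** The last hypothesis of [ex_on_friendship]: the star at [v] grows to all of [C] by pendant
    edges. *)
Definition radius2 C v :=
  forall u, u \in C -> u != v -> ~~ adj u v -> exists2 w, w \in nbhd C v & adj u w.

(** Inclusion-exclusion inside [C]. It turns a large degree sum into a large degree within
    [nbhd C v], as a matching there requires. *)
Lemma nbhd_common C u v :
  #|nbhd C u| + #|nbhd C v| <= #|C| + #|nbhd (nbhd C v) u|.
Proof.
have -> : nbhd (nbhd C v) u = nbhd C u :&: nbhd C v.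
  by apply/setP => w; rewrite !inE; case: (w \in C); rewrite ?andbF //= andbC.
by rewrite -cardsUI leq_add2r subset_leq_card // subUset !nbhd_sub.
Qed.

Lemma ex_on_growD C D : C \subset D ->
    (forall x, x \in D -> x \notin C -> exists2 y, y \in C & adj x y) ->
  ex_on C + #|D| <= ex_on D + #|C|.
Proof.
move=> sCD nbrD; have -> : #|D| = #|D :\: C| + #|C|.
  by rewrite -(cardsID C D) (setIidPr sCD) addnC.
rewrite addnA leq_add2r; apply: ex_on_grow => // x.
by rewrite inE => /andP[xC xD]; apply: nbrD.
Qed.

(** With the empty matching the construction is a spanning tree of [C]. *)
Lemma card_leq_ex_on C v : v \in C -> radius2 C v -> #|C| <= (ex_on C).+1.
Proof.
move=> vC rad.
have := ex_on_friendship simpleE vC (sub0set _) (PerfectMatching0 E) rad.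
by rewrite addn0; case: #|C|.
Qed.

Lemma dense_degree_bound C v k :
    v \in C -> radius2 C v -> ex_on C < k ->
    (forall u, u \in nbhd C v -> k < #|nbhd C u| + #|nbhd C v|) ->
  #|nbhd C v| <= 2 * (k - #|C|) + 1.
Proof.
move=> vC rad lt_ex deg; have nk := leq_trans (card_leq_ex_on vC rad) lt_ex.
have n0 : 0 < #|C| by apply/card_gt0P; exists v.
rewrite leqNgt; apply/negP => lt_deg.
(* A matching of this size in the neighbourhood of [v] yields [#|C| - 1 + (k - #|C| + 1) = k] edges,
   too many. *)
have [||S sS pmS] := @perfect_matching_exists T E simpleE (nbhd C v) (k - #|C|).+1.
- by move: lt_deg; clear; lia.
- move=> u /deg; have := nbhd_common C u v; move: nk; clear; lia.
have := ex_on_friendship simpleE vC sS pmS rad; move: nk n0 lt_ex; clear; lia.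
Qed.

Lemma dense_induced_bound C k :
    #|C| <= k -> (forall v, v \in C -> #|nbhd C v| <= 2 * (k - #|C|) + 1) ->
  #|induced C| <= k ^ 2 %/ 4 /\ (5 < k -> #|induced C| < k ^ 2 %/ 4).
Proof.
move=> nk deg; apply: (dense_quarter nk (card_induced_le simpleE C)).
by rewrite -handshake // -sum_nat_const; apply: leq_sum.
Qed.

(** Two disjoint stars form a forest with two more vertices than edges. *)
Lemma ex_on_two_stars C u v :
    u \in C -> v \in C -> u != v -> ~~ adj u v ->
    [disjoint nbhd C u & nbhd C v] ->
  #|nbhd C u| + #|nbhd C v| <= ex_on ([set u; v] :|: (nbhd C u :|: nbhd C v))
  /\ #|[set u; v] :|: (nbhd C u :|: nbhd C v)| = #|nbhd C u| + #|nbhd C v| + 2.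
Proof.
move=> uC vC neq_uv not_uv dis_uv; set D := _ :|: _.
have cardD : #|D| = #|nbhd C u| + #|nbhd C v| + 2.
  have cardN : #|nbhd C u :|: nbhd C v| = #|nbhd C u| + #|nbhd C v|.
    by rewrite cardsU (disjoint_setI0 dis_uv) cards0 subn0.
  rewrite /D cardsU cards2 neq_uv cardN (_ : [set u; v] :&: _ = set0).
    by rewrite cards0 subn0 addnC.
  apply/setP => w; rewrite !inE; have [->|_] /= := eqVneq w u.
    rewrite [adj v u]adjC (negPf not_uv) andbF orbF.
    by have := nbhd_notin simpleE C u; rewrite in_nbhd => /negPf.
  have [->|_] //= := eqVneq w v; rewrite (negPf not_uv) andbF /=.
  by have := nbhd_notin simpleE C v; rewrite in_nbhd => /negPf.
split=> //; have : ex_on [set u; v] + #|D| <= ex_on D + #|[set u; v]|.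
  apply: ex_on_growD; first exact: subsetUl.
  move=> x; rewrite inE => /orP[-> //|xN _]; move: xN; rewrite inE !in_nbhd.
  case/orP=> /andP[_ adj_x]; first by exists u; rewrite ?set21 // adjC.
  by exists v; rewrite ?set22 // adjC.
by rewrite cardD cards2 neq_uv; clear; lia.
Qed.

Lemma radius2P C v : v \in C ->
    (forall u, u \in C -> u != v -> ~~ adj u v -> ~~ [disjoint nbhd C u & nbhd C v]) ->
  radius2 C v.
Proof.
move=> vC meet u uC neq_uv not_uv.
have /pred0Pn[w /andP[/= wu wv]] := meet u uC neq_uv not_uv.
by exists w => //; move: wu; rewrite in_nbhd => /andP[].
Qed.

(** A vertex [u] too far from [v] would give two disjoint stars with at least [k] edges in total. *)
Lemma radius2_dense C v k :
    v \in C -> ex_on C < k ->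
    (forall u, u \in C -> k <= #|nbhd C u| + #|nbhd C v|) ->
  radius2 C v.
Proof.
move=> vC lt_ex deg; apply: radius2P => // u uC neq_uv not_uv.
apply/negP => dis; have [le_ex _] := ex_on_two_stars uC vC neq_uv not_uv dis.
have := leq_trans (deg u uC) le_ex; apply/negP; rewrite -ltnNge.
apply: leq_ltn_trans lt_ex; apply: ex_onS.
by rewrite !subUset !sub1set uC vC !nbhd_sub.
Qed.

Lemma induced_upper_bound C k : ex_on C < k -> #|induced C| <= k ^ 2 %/ 4.
Proof.
elim: {C}#|C| {-2}C (erefl #|C|) k => [|n IHn] C cardC k lt_ex.
  by have := card_induced_le simpleE C; rewrite cardC mul0n leqn0 muln_eq0 /= => /eqP->.
have [/existsP[v /andP[vC le_d]]|] := boolP [exists v in C, 2 * #|nbhd C v| <= k].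
  have cardCv : #|C :\ v| = n by have := cardsD1 v C; rewrite vC cardC => -[].
  rewrite (card_induced_rem simpleE vC).
  (* Deleting an isolated vertex may leave [ex_on] unchanged; it costs no edge, so [k] is kept. *)
  have [d0|] := posnP #|nbhd C v|.
    rewrite d0 addn0; apply: IHn => //.
    by apply: leq_ltn_trans lt_ex; apply: ex_onS (subD1set _ _).
  case/card_gt0P=> y; rewrite in_nbhd => /andP[yC vy].
  have lt_exv : ex_on (C :\ v) < ex_on C.
    by apply: (@ex_on_pendant _ _ simpleE _ _ v y) => //; [exact: subD1set | rewrite !inE eqxx].
  case: k lt_ex le_d => // k lt_ex le_d; rewrite quarter_sqr_step.
  apply: leq_add; last by move: le_d; clear; lia.
  by apply: IHn => //; apply: leq_trans lt_exv _.
(* From here on all degrees exceed k/2, and the matching argument applies at every vertex. *)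
rewrite negb_exists => /forallP deg.
have {}deg v : v \in C -> k < 2 * #|nbhd C v|.
  by move=> vC; have := deg v; rewrite vC /= -ltnNge.
have degD u v : u \in C -> v \in C -> k < #|nbhd C u| + #|nbhd C v|.
  by move=> /deg + /deg; clear; lia.
have rad v : v \in C -> radius2 C v.
  by move=> vC; apply: radius2_dense lt_ex _ => // u uC; apply/ltnW/degD.
have /card_gt0P[v0 v0C] : 0 < #|C| by rewrite cardC.
have nk : #|C| <= k by apply: leq_trans (card_leq_ex_on v0C (rad _ v0C)) lt_ex.
apply: (dense_induced_bound nk _).1 => v vC.
apply: dense_degree_bound lt_ex _ => //; first exact: rad.
by move=> u /(subsetP (nbhd_sub _ _ _)) uC; apply: degD.
Qed.


(* Were v at distance at least 3 from u, the stars at u and v would already carry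
   k - 1 edges, and any further edge at a neighbour of u improves on this. *)
Lemma radius2_extremal C v k h :
    v \in C -> ex_on C < k -> 1 < h -> k <= 2 * h + 1 ->
    (forall u, u \in C -> h <= #|nbhd C u|) ->
  radius2 C v.
Proof.
move=> vC lt_ex h1 kh deg; apply: radius2P => // u uC neq_uv not_uv.
apply/negP => dis; have := ex_on_two_stars uC vC neq_uv not_uv dis.
set D := _ :|: _ => -[le_ex cardD].
have sD : D \subset C by rewrite !subUset !sub1set uC vC !nbhd_sub.
have uD : u \in D by rewrite !inE eqxx.
have vD : v \in D by rewrite !inE eqxx !orbT.
have NuD : nbhd C u \subset D by rewrite /D setUCA subsetUl.
have NvD : nbhd C v \subset D by rewrite /D setUA subsetUr.
have nbrD S : u \in S -> v \in S -> forall w, w \in D -> w \notin S ->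
    exists2 y, y \in S & adj w y.
  move=> uS vS w; rewrite !inE => /orP[/orP[]/eqP->|]; rewrite ?uS ?vS //.
  by case/orP=> /andP[_ adj_w] _; [exists u | exists v]; rewrite // adjC.
(* The two stars have at least [2 * h >= k - 1] edges, so they are optimal on [D]; each case below
   contradicts this or [ex_on C < k]. *)
have exD' : ex_on D < #|nbhd C u| + #|nbhd C v| + 1.
  by move: (ex_onS E sD) lt_ex (deg u uC) (deg v vC) kh; clear; lia.
have /card_gt0P[x xNu] : 0 < #|nbhd C u| by apply: leq_trans (deg u uC); apply: ltnW.
have := xNu; rewrite in_nbhd => /andP[xC ux].
have neq_xu : x != u by rewrite eq_sym; apply: adj_neq ux.
have xNv : ~~ adj v x.
  apply/negP => vx; have /pred0P/(_ x) := dis.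
  by rewrite /= !in_nbhd xC ux vx.
have neq_xv : x != v by apply: contraNneq not_uv => <-.
have sND : nbhd C x \subset D.
  apply/subsetP => w; rewrite in_nbhd => /andP[wC xw]; apply/negPn/negP => wD.
  have : ex_on D < ex_on C.
    apply: (@ex_on_pendant _ _ simpleE _ _ w x) => //; by rewrite adjC.
  by move: lt_ex le_ex (deg u uC) (deg v vC) kh; clear; lia.
have /subsetPn[y yNx] : ~~ (nbhd C x \subset [set u]).
  by apply/negP => /subset_leq_card; have := deg x xC; rewrite cards1; move: h1; clear; lia.
rewrite inE => neq_yu; have := yNx; rewrite in_nbhd => /andP[yC xy].
have neq_yv : y != v by apply: contraNneq xNv => <-; rewrite adjC.
have neq_xy := adj_neq simpleE xy.
have := subsetP sND y yNx; rewrite 3!inE (negPf neq_yu) inE (negPf neq_yv) /=.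
rewrite inE => /orP[yNu|yNv].
  (* Both [x] and [y] lie in the star at [u]: the triangle [u x y] gains an edge. *)
  have := yNu; rewrite in_nbhd => /andP[_ uy].
  pose S := x |: (y |: [set u; v]).
  have exS : ex_on [set u; v] + 3 <= ex_on S.
    apply: (@ex_on_triangle _ _ simpleE _ _ x y u) => //; rewrite ?inE ?eqxx ?orbT //.
    - by rewrite /S setUA subsetUr.
    - by rewrite negb_or neq_xu.
    - by rewrite negb_or neq_yu.
    - by rewrite adjC.
    - by rewrite adjC.
  have cardS : #|S| = 4.
    by rewrite /S !cardsU1 !inE !negb_or cards1 neq_xy neq_xu neq_xv neq_yu neq_yv neq_uv.
  have : ex_on S + #|D| <= ex_on D + #|S|.
    apply: ex_on_growD.
      rewrite /S !subUset !sub1set uD vD (subsetP NuD _ xNu) (subsetP NuD _ yNu) //.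
    by apply: nbrD; rewrite !inE eqxx ?orbT.
  by rewrite cardS cardD; move: exS exD'; clear; lia.
have := yNv; rewrite in_nbhd => /andP[_ vy].
have yNu : y \notin nbhd C u.
  by apply/negP => yNu; have /pred0P/(_ y) := dis; rewrite /= yNu yNv.
have vNu : v \notin nbhd C u by rewrite in_nbhd (negPf not_uv) andbF.
(* The edge [x y] joins the two stars: the path [u x y v] leads to a spanning tree of [D]. *)
pose S1 := u |: nbhd C u; pose S2 := y |: S1; pose S3 := v |: S2.
have exS1 : ex_on [set u] + #|S1| <= ex_on S1 + 1.
  rewrite -(cards1 u); apply: ex_on_growD; first exact: subsetUl.
  move=> w; rewrite !inE => /orP[-> //|/andP[_ uw] _]; exists u; rewrite ?set11 //.
  by rewrite adjC.
have exS2 : ex_on S1 < ex_on S2.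
  apply: (@ex_on_pendant _ _ simpleE _ _ y x); rewrite ?subsetUr ?setU11 //.
  - by rewrite in_setU1 negb_or neq_yu.
  - by rewrite !in_setU1 xNu !orbT.
  - by rewrite adjC.
have exS3 : ex_on S2 < ex_on S3.
  apply: (@ex_on_pendant _ _ simpleE _ _ v y); rewrite ?subsetUr ?setU11 //.
  - by rewrite !in_setU1 !negb_or (eq_sym v) neq_yv (eq_sym v) neq_uv.
  - by rewrite !in_setU1 eqxx !orbT.
have cardS : #|S3| = #|nbhd C u| + 3.
  rewrite /S3 /S2 /S1 !cardsU1 !in_setU1 !negb_or yNu vNu.
  by rewrite (eq_sym v) neq_yv (eq_sym v) neq_uv neq_yu nbhd_notin //; clear; lia.
have cardS1 : #|S1| = #|nbhd C u|.+1 by rewrite cardsU1 nbhd_notin.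
have : ex_on S3 + #|D| <= ex_on D + #|S3|.
  apply: ex_on_growD.
    by rewrite !subUset !sub1set vD uD NuD (subsetP NvD _ yNv).
  by apply: nbrD; rewrite !inE eqxx ?orbT.
by rewrite cardS cardD; move: exS1 exS2 exS3 cardS1 exD'; clear; lia.
Qed.

(** Deleting a vertex of smaller degree would leave more edges than the upper bound for [k - 1]
    allows. *)
Lemma degree_lower_bound C k v :
    ex_on C < k -> #|induced C| = k ^ 2 %/ 4 -> v \in C -> 0 < #|nbhd C v| ->
  k./2 <= #|nbhd C v|.
Proof.
move=> lt_ex card_e vC /card_gt0P[y]; rewrite in_nbhd => /andP[yC vy].
have lt_exv : ex_on (C :\ v) < ex_on C.
  by apply: (@ex_on_pendant _ _ simpleE _ _ v y) => //; [exact: subD1set | rewrite !inE eqxx].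
case: k lt_ex card_e => // k lt_ex; rewrite quarter_sqr_step.
rewrite (card_induced_rem simpleE vC).
have := induced_upper_bound (leq_trans lt_exv lt_ex : ex_on (C :\ v) < k).
clear; lia.
Qed.

Lemma extremal_order C k :
    5 < k -> ex_on C < k -> #|induced C| = k ^ 2 %/ 4 ->
    (forall v, v \in C -> k./2 <= #|nbhd C v|) ->
    (forall v, v \in C -> radius2 C v) ->
  #|C| = k.
Proof.
move=> k5 lt_ex card_e deg rad.
have e4 : k ^ 2 <= 4 * #|induced C| + 1.
  rewrite card_e quarter_sqrE uphalf_half -{1}[k]odd_double_half -mulnn; clear.
  by case: (odd k); lia.
have /card_gt0P[v0 v0C] : 0 < #|C|.
  rewrite lt0n; apply/eqP => C0; have := card_induced_le simpleE C.
  by move: e4 k5; rewrite C0 -mulnn; clear; nia.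
have nk : #|C| <= k by apply: leq_trans (card_leq_ex_on v0C (rad _ v0C)) lt_ex.
apply/eqP; rewrite eqn_leq nk leqNgt; apply/negP => lt_nk.
(* For [5 < k] the dense bound is strict, contradicting extremality. *)
suff degU v : v \in C -> #|nbhd C v| <= 2 * (k - #|C|) + 1.
  have [_ /(_ k5)] := dense_induced_bound nk degU.
  by rewrite card_e ltnn.
have [vm vmC max_vm] : exists2 vm, vm \in C & forall v, v \in C -> #|nbhd C v| <= #|nbhd C vm|.
  by case: (arg_maxnP (fun v => #|nbhd C v|) v0C) => vm vmC max_vm; exists vm.
have [big|small] := ltnP k (#|nbhd C vm| + k./2).
  move=> vC; apply: leq_trans (max_vm v vC) _.
  apply: dense_degree_bound lt_ex _ => //; first exact: rad.
  move=> u /(subsetP (nbhd_sub _ _ _)) uC; apply: leq_trans big _.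
  by rewrite addnC leq_add2r deg.
(* Now no degree exceeds ceil(k/2). If some vertex has degree floor(k/2), then, as [#|C| < k], the
   degree sum is too small; otherwise any two degrees add up to more than [k]. *)
have [/existsP[w /andP[wC /eqP dw]]|] := boolP [exists w in C, #|nbhd C w| == k./2].
  have := handshake simpleE C; rewrite (bigD1 w) //= dw => hs.
  have : \sum_(i in C | i != w) #|nbhd C i| <= #|C|.-1 * (k - k./2).
    have -> : #|C|.-1 = #|C :\ w| by rewrite (cardsD1 w C) wC.
    rewrite -sum_nat_const [X in _ <= X](eq_bigl (fun i => (i \in C) && (i != w))).
      apply: leq_sum => i /andP[iC _]; have := max_vm i iC; move: small; clear; lia.
    by move=> i; rewrite !inE andbC.
  move=> le; suff: False by [].
  move: hs le e4 lt_nk k5 card_e; rewrite quarter_sqrE uphalf_half -mulnn.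
  move: (\sum_(i in C | _) _) => s; move: #|induced C| #|C| => e n; clear.
  move: (odd_double_half k); move: (odd k) k./2 => b a <-; case: b; nia.
rewrite negb_exists => /forallP degS.
have {degS}degS w : w \in C -> k./2 < #|nbhd C w|.
  by move=> wC; have := degS w; rewrite wC /= eq_sym ltn_neqAle => ->; apply: deg.
move=> vC; apply: dense_degree_bound lt_ex _ => //; first exact: rad.
move=> u /(subsetP (nbhd_sub _ _ _)) /degS; have := degS v vC; clear; lia.
Qed.

(** An edge in the neighbourhood of [v] is a matching of size one, which already yields [#|C|]
    edges. *)
Lemma extremal_triangle_free C v x y :
    #|C| = (ex_on C).+1 -> v \in C -> radius2 C v ->
  x \in nbhd C v -> y \in nbhd C v -> ~~ adj x y.
Proof.
move=> cardC vC rad xN yN; apply/negP => xy.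
have pm1 : perfect_matching E 1 (x |: (y |: set0)).
  by apply: PerfectMatchingS (PerfectMatching0 E) => //; rewrite inE.
have sN : x |: (y |: set0) \subset nbhd C v.
  by rewrite !subUset !sub1set xN yN sub0set.
have := ex_on_friendship simpleE vC sN pm1 rad.
by rewrite cardC; clear; lia.
Qed.

Lemma extremal_bipartition C k :
    5 < k -> ex_on C < k -> #|induced C| = k ^ 2 %/ 4 ->
    (forall v, v \in C -> 0 < #|nbhd C v|) ->
  exists A B, [/\ A :|: B = C, [disjoint A & B], #|A| = k./2, #|B| = uphalf k
    & induced C = [set [set a; b] | a in A, b in B]].
Proof.
move=> k5 lt_ex card_e pos.
have deg v : v \in C -> k./2 <= #|nbhd C v|.
  by move=> vC; apply: degree_lower_bound lt_ex card_e vC (pos v vC).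
have rad v : v \in C -> radius2 C v.
  move=> vC; apply: (@radius2_extremal _ _ k k./2) => //; move: k5; clear; lia.
have cardC := extremal_order k5 lt_ex card_e deg rad.
have /card_gt0P[v0 v0C] : 0 < #|C| by rewrite cardC; move: k5; clear; lia.
have cardCX : #|C| = (ex_on C).+1.
  apply/eqP; rewrite eqn_leq (card_leq_ex_on v0C (rad _ v0C)) /= cardC; exact: lt_ex.
have tri_free v x y : v \in C -> x \in nbhd C v -> y \in nbhd C v -> ~~ adj x y.
  by move=> vC; apply: extremal_triangle_free => //; apply: rad.
(* If every degree were at most [(k - 1)/2], the degree sum over [k] vertices would be too small. *)
have [v vC dv] : exists2 v, v \in C & k <= 2 * #|nbhd C v|.
  have [/existsP[v /andP[]]|] := boolP [exists v in C, k <= 2 * #|nbhd C v|].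
    by exists v.
  rewrite negb_exists => /forallP small.
  have : \sum_(v in C) 2 * #|nbhd C v| <= #|C| * k.-1.
    rewrite -sum_nat_const; apply: leq_sum => v vC.
    by have := small v; rewrite vC /= -ltnNge; clear; lia.
  rewrite -big_distrr /= handshake // cardC card_e quarter_sqrE uphalf_half.
  move: k5 (odd_double_half k); clear; move: (odd k) k./2 => b a k5 def_k.
  by move: k5; rewrite -def_k; case: b {def_k}; nia.
have /card_gt0P[u uN] := pos v vC.
have := uN; rewrite in_nbhd => /andP[uC vu].
have disN : [disjoint nbhd C u & nbhd C v].
  apply/pred0P => w /=; apply/negP => /andP[wu wv].
  have := tri_free v u w vC uN wv.
  by move: wu; rewrite in_nbhd => /andP[_ ->].
have cardU : #|nbhd C u :|: nbhd C v| = #|nbhd C u| + #|nbhd C v|.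
  by rewrite cardsU (disjoint_setI0 disN) cards0 subn0.
have leU : #|nbhd C u :|: nbhd C v| <= k.
  by rewrite -cardC subset_leq_card // subUset !nbhd_sub.
have du := deg u uC; rewrite cardU in leU.
(* The two degrees are at least floor(k/2) and ceil(k/2) but add up to at most [k], so both are
   determined. *)
have cardA : #|nbhd C u| = k./2 by move: du dv leU; clear; lia.
have cardB : #|nbhd C v| = uphalf k.
  by move: du dv leU; rewrite uphalf_half; have := odd_double_half k; clear; lia.
have defC : nbhd C u :|: nbhd C v = C.
  apply/eqP; rewrite eqEcard subUset !nbhd_sub cardU cardA cardB cardC uphalf_half.
  by have := odd_double_half k; clear; lia.
(* Triangle-freeness makes both sides independent, and counting edges shows that every cross pair
   occurs. *)
exists (nbhd C u), (nbhd C v); split=> //; apply/eqP; rewrite eqEcard; apply/andP; split.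
  apply/subsetP => e /(edgeP simpleE)[a [b [aC bN ->]]].
  move: bN; rewrite in_nbhd => /andP[bC ab].
  move: aC bC; rewrite -{1 2}defC !inE -!in_nbhd => /orP[aA|aB] /orP[bA|bB].
  - by have := tri_free u a b uC aA bA; rewrite ab.
  - by apply/imset2P; exists a b.
  - by rewrite set2C; apply/imset2P; exists b a.
  - by have := tri_free v a b vC aB bB; rewrite ab.
rewrite card_e quarter_sqrE -cardA -cardB curry_imset2X.
by apply: leq_trans (leq_imset_card _ _) _; rewrite cardsX.
Qed.

End Extremal.

(** * Bipartite graphs without even cycles are forests *)

Section BipartiteForest.
Variables (T : finType) (E : {set {set T}}) (c : T -> bool).
Hypothesis simpleE : simple_graph E.
Hypothesis colorE : forall x y, adj E x y -> c y = ~~ c x.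
Hypothesis freeE : even_cycle_free E.

Lemma path_color x p i :
  path (adj E) x p -> i <= size p -> c (nth x (x :: p) i) = odd i (+) c x.
Proof.
move=> /(pathP x) pth; elim: i => [|i IHi] // lt_ip.
by rewrite /= (colorE (pth i lt_ip)) IHi 1?ltnW // addNb.
Qed.

(** The closing edge would give a cycle, of even length by the colouring and hence of length at
    least 4. *)
Lemma no_closed_path x p :
  path (adj E) x p -> uniq (x :: p) -> 1 < size p -> ~~ adj E (last x p) x.
Proof.
move=> pth uniq_p size_p; apply/negP => closing.
have odd_p : odd (size p).
  have := path_color pth (leqnn _); rewrite nth_last /= => c_last.
  by have := colorE closing; rewrite c_last; case: (odd _) => //; case: (c x).
pose f (i : 'I_(size p).+1) := nth x (x :: p) i.
have /even_cycle_freeP/(_ _ f) := freeE; apply; split.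
- by move: size_p odd_p; case: (size p) => [|[|[|]]].
- by rewrite /= odd_p.
- by move=> i j /eqP; rewrite nth_uniq // => /eqP/val_inj.
move=> i; rewrite /f /=; have [lt_i|ge_i] := ltnP i (size p).
  by rewrite modn_small //; have /(pathP x) := pth; apply.
have -> : i = size p :> nat by apply/eqP; rewrite eqn_leq ge_i -ltnS ltn_ord.
by rewrite modnn -[size p]/((size (x :: p)).-1) nth_last.
Qed.

(** If all degrees are at least 2, every path extends at its front, since otherwise it closes up to
    a cycle; so there would be a path with more than [#|T|] vertices. *)
Lemma low_degree_vertex (C : {set T}) :
  C != set0 -> exists2 v, v \in C & #|nbhd E C v| <= 1.
Proof.
case/set0Pn=> x0 x0C.
have [/existsP[v /andP[]]|] := boolP [exists v in C, #|nbhd E C v| <= 1].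
  by exists v.
rewrite negb_exists => /forallP deg.
have {}deg v : v \in C -> 1 < #|nbhd E C v|.
  by move=> vC; have := deg v; rewrite vC /= -ltnNge.
have long_path m : exists x p,
    [/\ x \in C, size p = m, path (adj E) x p & uniq (x :: p)].
  elim: m => [|m [x [p [xC size_p pth uniq_p]]]]; first by exists x0, [::].
  have [/subsetP sub|/subsetPn[y]] := boolP (nbhd E C x \subset x :: p).
    have sNp y : y \in nbhd E C x -> y \in p.
      move=> yN; have := sub y yN; rewrite inE => /orP[/eqP yx|//].
      by have := nbhd_notin simpleE C x; rewrite -{1}yx yN.
    (* A neighbour of [x] on the path other than the next vertex closes a cycle. *)
    have [y [yN yp]] : exists y, y \in nbhd E C x /\ y \in behead p.
      have /subsetPn[y yN] : ~~ (nbhd E C x \subset [set head x p]).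
        by apply/negP => /subset_leq_card; rewrite cards1 leqNgt deg.
      rewrite inE => neq_y; exists y; split=> //; have := sNp y yN.
      by move: neq_y; case: (p) => //= z q; rewrite inE => /negPf->.
    move: yN; rewrite in_nbhd => /andP[_ xy].
    case: p pth uniq_p yp {size_p sub sNp} => //= z p pth uniq_p yp.
    case/splitPr: yp pth uniq_p => p1 p2.
    rewrite -cat_rcons cat_path => pth uniq_p.
    have := @no_closed_path x (z :: rcons p1 y).
    rewrite /= last_rcons size_rcons [adj E y x]adjC xy => no_path.
    suff: false by []; apply: no_path => //.
      by case/and3P: pth => -> ->.
    have : uniq ((x :: z :: rcons p1 y) ++ p2) := uniq_p.
    by rewrite cat_uniq => /andP[].
  rewrite in_nbhd => /andP[yC xy] yp; exists y, (x :: p).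
  by split; rewrite //= ?size_p ?pth 1?adjC ?xy // yp.
have [x [p [_ size_p _ /card_uniqP]]] := long_path #|T|.
by move=> card_p; have := max_card (mem (x :: p)); rewrite card_p /= size_p ltnn.
Qed.

Lemma forest_bound (C : {set T}) : #|induced E C| <= #|C|.-1.
Proof.
elim: {C}#|C| {-2}C (erefl #|C|) => [|n IHn] C cardC.
  by have := card_induced_le simpleE C; rewrite cardC mul0n leqn0 muln_eq0 /= => /eqP->.
have [|v vC dv] := @low_degree_vertex C; first by rewrite -card_gt0 cardC.
have cardCv : #|C :\ v| = n by have := cardsD1 v C; rewrite vC cardC => -[].
(* The bound by [card_nbhd_ltn] matters for the last vertex, where [n.-1] truncates to 0. *)
have := card_nbhd_ltn simpleE vC; rewrite (card_induced_rem simpleE vC) cardC.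
by have := IHn _ cardCv; rewrite cardCv; move: dv; clear; lia.
Qed.

End BipartiteForest.

Lemma induced_setT (T : finType) (E : {set {set T}}) : induced E setT = E.
Proof. by apply/setP => e; rewrite inE subsetT andbT. Qed.

Lemma simple_graph_sub (T : finType) (E F : {set {set T}}) :
  F \subset E -> simple_graph E -> simple_graph F.
Proof.
move=> /subsetP sFE /forallP simpleE; apply/forallP => e; apply/implyP => /sFE eE.
by have := simpleE e; rewrite eE.
Qed.

(** * Complete bipartite graphs: size, extremal number, and recognition *)

Section CompleteBipartite.
Variables a b : nat.

Lemma K_bipP (e : {set 'I_a + 'I_b}) :
  reflect (exists i j, e = [set inl i; inr j]) (e \in K_bip a b).
Proof.
by apply: (iffP imset2P) => [[i j _ _ ->]|[i [j ->]]]; [exists i, j | exists i j].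
Qed.

Lemma simple_K_bip : simple_graph (K_bip a b).
Proof. by apply/forallP => e; apply/implyP => /K_bipP[i [j ->]]; rewrite cards2. Qed.

Lemma no_isolated_K_bip : 0 < a -> 0 < b -> no_isolated (K_bip a b).
Proof.
move=> a0 b0; apply/forallP => -[i|j]; apply/existsP.
  by exists [set inl i; inr (Ordinal b0)]; rewrite set21 andbT; apply/K_bipP; exists i, (Ordinal b0).
by exists [set inl (Ordinal a0); inr j]; rewrite set22 andbT; apply/K_bipP; exists (Ordinal a0), j.
Qed.

Lemma card_K_bip : #|K_bip a b| = a * b.
Proof.
pose edge (ij : 'I_a * 'I_b) : {set 'I_a + 'I_b} := [set inl ij.1; inr ij.2].
have -> : K_bip a b = edge @: setT.
  apply/setP => e; apply/K_bipP/imsetP => [[i [j ->]]|[[i j] _ ->]].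
    by exists (i, j).
  by exists i, j.
rewrite card_imset ?cardsT ?card_prod ?card_ord // => -[i j] [i' j'] eq_e.
have : inl i \in edge (i', j') by rewrite -eq_e set21.
have : inr j \in edge (i', j') by rewrite -eq_e set22.
by rewrite !inE /= orbF => /eqP[->] /eqP[->].
Qed.

(** An even-cycle-free subgraph is coloured by the two sides, hence a forest on [a + b] vertices. *)
Lemma ex_K_bip : ex_even_cycles (K_bip a b) <= (a + b).-1.
Proof.
apply/bigmax_leqP => F /andP[]; rewrite powersetE => sF freeF.
pose c (x : 'I_a + 'I_b) := if x is inl _ then true else false.
have := @forest_bound _ F c (simple_graph_sub sF simple_K_bip) _ freeF setT.
rewrite induced_setT cardsT card_sum !card_ord; apply.
move=> x y /(subsetP sF)/K_bipP[i [j eq_e]].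
have neq_xy : x != y.
  by apply: (adj_neq simple_K_bip); rewrite /adj eq_e; apply/K_bipP; exists i, j.
have := set21 x y; have := set22 x y; rewrite eq_e !inE.
by case/orP=> /eqP yE /orP[]/eqP xE; move: neq_xy; rewrite xE yE ?eqxx.
Qed.

End CompleteBipartite.

Lemma complete_bipartite_iso (T : finType) (E : {set {set T}}) (A B : {set T}) :
    A :|: B = setT -> [disjoint A & B] -> 0 < #|A| -> 0 < #|B| ->
    E = [set [set x; y] | x in A, y in B] ->
  graph_iso E (K_bip #|A| #|B|).
Proof.
move=> defT dis /card_gt0P[x0 x0A] /card_gt0P[y0 y0B] defE.
have inB x : x \notin A -> x \in B.
  by move=> xA; have := in_setT x; rewrite -defT inE (negPf xA).
have notA y : y \in B -> y \in A = false.
  by move=> yB; apply: contraTF yB => yA; rewrite (disjointFr dis yA).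
(* The two sides are enumerated separately; [x0] and [y0] supply the defaults of [enum_rank_in]. *)
pose f x : 'I_#|A| + 'I_#|B| :=
  if x \in A then inl (enum_rank_in x0A x) else inr (enum_rank_in y0B x).
pose g (s : 'I_#|A| + 'I_#|B|) :=
  match s with inl i => enum_val i | inr j => enum_val j end.
have fK : cancel f g.
  move=> x; rewrite /f; have [xA|/inB xB] := boolP (x \in A).
    exact: enum_rankK_in.
  exact: enum_rankK_in.
have gK : cancel g f.
  case=> i; rewrite /f /=; first by rewrite enum_valP enum_valK_in.
  by rewrite notA ?enum_valP // enum_valK_in.
exists f; split; first by exists g.
move=> e; rewrite defE; apply/imset2P/K_bipP => [[x y xA yB ->]|[i [j eq_fe]]].
  exists (enum_rank_in x0A x), (enum_rank_in y0B y).
  by rewrite imsetU !imset_set1 /f xA (notA y yB).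
exists (enum_val i) (enum_val j); rewrite ?enum_valP //.
have <- : g @: (f @: e) = e.
  by rewrite -imset_comp -[RHS]imset_id; apply: eq_imset => x; apply: fK.
by rewrite eq_fe imsetU !imset_set1.
Qed.

Theorem theorem1p2 (k : nat) (hk : 4 <= k) :
  (* E_{C_e}(k) = floor(k^2/4): it is an upper bound ... *)
  ((forall (T : finType) (E : {set {set T}}),
      simple_graph E -> no_isolated E -> ex_even_cycles E < k ->
      #|E| <= k ^ 2 %/ 4)
  (* ... and it is attained *)
   /\ (exists (T : finType) (E : {set {set T}}),
      [/\ simple_graph E, no_isolated E, ex_even_cycles E < k
        & #|E| = k ^ 2 %/ 4]))
  /\
  (* uniqueness of the extremal graph for k >= 6 *)
  (6 <= k ->
   forall (T : finType) (E : {set {set T}}),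
      simple_graph E -> no_isolated E -> ex_even_cycles E < k ->
      #|E| = k ^ 2 %/ 4 ->
      graph_iso E (K_bip (k %/ 2) (k.+1 %/ 2))).
Proof.
split; first split.
- move=> T E simpleE _; rewrite -{1 2}[E]induced_setT.
  exact: induced_upper_bound.
- exists ('I_(k./2) + 'I_(uphalf k))%type, (K_bip k./2 (uphalf k)); split.
  + exact: simple_K_bip.
  + by apply: no_isolated_K_bip; lia.
  + by have := @ex_K_bip k./2 (uphalf k); lia.
  + by rewrite card_K_bip quarter_sqrE.
move=> k6 T E simpleE iso0 lt_ex card_e; rewrite !divn2.
(* The absence of isolated vertices makes all degrees positive, so [degree_lower_bound] reaches
   every vertex. *)
have pos v : v \in setT -> 0 < #|nbhd E setT v|.
  move=> _; have /existsP[e /andP[eE ve]] := forallP iso0 v.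
  rewrite -[E]induced_setT in eE; have [y yN _] := edge_nbhd simpleE eE ve.
  by apply/card_gt0P; exists y.
have [||A [B [defT dis cardA cardB]]] := extremal_bipartition simpleE k6 _ _ pos.
- by rewrite /ex_on induced_setT.
- by rewrite induced_setT.
rewrite induced_setT -cardA -[_./2]/(uphalf k) -cardB.
by apply: complete_bipartite_iso; rewrite ?cardA ?cardB //; lia.
Qed.
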